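(* Let $\pi$ be a permutation of $[n]$, $n\ge 1$, and let $0\le d \leq \operatorname{des}(\pi)$. Then $$\operatorname{is}(\pi) + d \;\leq\; \operatorname{ls}_d(\pi) \;\leq\; \min\{\operatorname{is}_{d + 1}(\pi),\ \operatorname{asc}(\pi) + d + 1\}.$$
   Context: Permutations of $[n]=\{1,\dots,n\}$ are written as words $\pi(1)\cdots\pi(n)$. For a sequence $\sigma$ of length $m$ of distinct numbers, $\operatorname{Des}(\sigma)=\{i\in[m-1] : \sigma(i)>\sigma(i+1)\}$, $\operatorname{des}(\sigma)=\#\operatorname{Des}(\sigma)$, and $\operatorname{asc}(\sigma)$ is the number of $i\in[m-1]$ with $\sigma(i)<\sigma(i+1)$. For $I=\{i_1<\cdots<i_k\}\subseteq[n]$, $\pi_I=\pi(i_1)\cdots\pi(i_k)$. $\operatorname{is}(\pi)$ is the length of a longest increasing subsequence of $\pi$. For $k\ge1$, $\operatorname{is}_k(\pi)$ is the maximum length of a subsequence of $\pi$ that can be written as the union of $k$ increasing subsequences. For $d\ge0$, $\operatorname{ls}_d(\pi)=\max\{\#I : I\subseteq[n],\ \operatorname{des}(\pi_I)=d\}$ (equal to $0$ if there is no such $I$). *)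

(* Defs.v *)
From mathcomp Require Import all_boot all_fingroup.

Set Implicit Arguments.
Unset Strict Implicit.
Unset Printing Implicit Defensive.

(* Positions and values are numbered from 0: a permutation of [n] is an element
   of 'S_n acting on 'I_n = {0, ..., n-1}. *)

Definition Des (s : seq nat) : {set 'I_(size s).-1} :=
  [set i : 'I_(size s).-1 | nth 0 s i > nth 0 s i.+1].

Definition des (s : seq nat) : nat := #|Des s|.

Definition asc (s : seq nat) : nat :=
  #|[set i : 'I_(size s).-1 | nth 0 s i < nth 0 s i.+1]|.

Definition word (n : nat) (pi : 'S_n) : seq nat :=
  [seq val (pi i) | i <- enum 'I_n].

(* [enum I] lists the elements of I in increasing order, so this is the word
   pi(i_1) ... pi(i_k) for I = {i_1 < ... < i_k}. *)
Definition subword (n : nat) (pi : 'S_n) (I : {set 'I_n}) : seq nat :=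
  [seq val (pi i) | i <- enum I].

(* Subsequences of pi are represented by their sets of positions. *)
Definition increasing_on (n : nat) (pi : 'S_n) (I : {set 'I_n}) : bool :=
  sorted ltn (subword pi I).

(* The J j may be empty and need not be disjoint. *)
Definition k_increasing_on (n : nat) (k : nat) (pi : 'S_n) (I : {set 'I_n}) :
    bool :=
  [exists J : {ffun 'I_k -> {set 'I_n}},
    [forall j, increasing_on pi (J j)] && (I == \bigcup_(j < k) J j)].

Definition lis (n : nat) (pi : 'S_n) : nat :=
  \max_(I : {set 'I_n} | increasing_on pi I) #|I|.

Definition lis_k (n : nat) (k : nat) (pi : 'S_n) : nat :=
  \max_(I : {set 'I_n} | k_increasing_on k pi I) #|I|.

(* A maximum over an empty range is 0. *)
Definition ls (n : nat) (d : nat) (pi : 'S_n) : nat :=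
  \max_(I : {set 'I_n} | des (subword pi I) == d) #|I|.

(* Main.v *)
Require Import Defs.
From mathcomp Require Import all_boot all_fingroup.

(** Three facts about words carry the proof.  Passing to a subword can only
    lose descents and can only lose ascents ([nadj_subseq]), because a descent
    (ascent) between two letters forces one somewhere along any detour between
    them.  A nonempty word with distinct letters has length one more than its
    number of ascents and descents together ([size_asc_des]).  Cutting a word
    with d descents at its descents leaves d + 1 increasing runs
    ([pairwise_run_label]).

    The upper bounds follow at once: runs give d + 1 increasing subsequences
    that cover pi_I, and #I <= asc (pi_I) + d + 1 <= asc pi + d + 1.

    For the lower bound, adding one position to I changes the number of descents
    by 0 or 1 ([des_subwordU1]): both descents and ascents are nondecreasing, and
    their sum grows by at most 1.  If I is largest among the sets with d
    descents and d < des pi, then I is not everything, and by maximality any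
    added position creates exactly one new descent.  Hence ls_d strictly
    increases for d <= des pi, starting from ls_0, which is at least is pi
    ([exists_des_card_ge_lis]). *)

Set Implicit Arguments.
Unset Strict Implicit.
Unset Printing Implicit Defensive.

(** * Counting adjacent pairs in a word *)

Section AdjacentPairs.

Variable T : eqType.
Implicit Types (r : rel T) (s t : seq T) (x y : T).

(** Descents and ascents are both of this form, for [gtn] and [ltn]; the list
    recursion it unfolds to replaces the ordinal-indexed sets of positions. *)
Definition nadj r s : nat := count (fun p => r p.1 p.2) (zip s (behead s)).

Lemma nadj_cons2 r x y s : nadj r (x :: y :: s) = r x y + nadj r (y :: s).
Proof. by []. Qed.

Lemma leq_nadj_cons r x s : nadj r s <= nadj r (x :: s).
Proof. by case: s => [|y s] //; rewrite nadj_cons2 leq_addl. Qed.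

(** The hypothesis on [r] says that the complement of [r] is transitive: a pair
    related by [r] stays visible as an adjacent related pair when letters are
    inserted inside it. *)
Lemma nadj_cons_subseq r x s t :
    (forall y x z, r x z -> r x y || r y z) ->
  subseq s t -> nadj r (x :: s) <= nadj r (x :: t).
Proof.
move=> r_cotrans; elim: t s x => [|b t IHt] [|c s] x //=.
case: eqP => [<-|_] s_t; first by rewrite !nadj_cons2 leq_add2l IHt.
(* The first letter b of t is not matched: insert it between x and c. *)
apply: leq_trans (_ : nadj r (x :: b :: c :: s) <= _).
  rewrite !nadj_cons2 addnA leq_add2r.
  case rxc: (r x c) => //.
  by have /orP[] := r_cotrans b _ _ rxc => ->; rewrite ?leq_addr ?leq_addl.
by rewrite [leqLHS]nadj_cons2 [leqRHS]nadj_cons2 leq_add2l IHt.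
Qed.

Lemma nadj_subseq r s t :
    (forall y x z, r x z -> r x y || r y z) ->
  subseq s t -> nadj r s <= nadj r t.
Proof.
move=> r_cotrans; elim: t s => [|b t IHt] [|c s] //=.
case: eqP => [<-|_] s_t; first exact: nadj_cons_subseq.
by apply: leq_trans (IHt _ s_t) _; apply: leq_nadj_cons.
Qed.

(** Letters are labelled by the number of [r]-pairs in the suffix that they
    start, so that equal labels mean that no [r]-pair separates two letters.
    If x comes before y and [r x y], then x followed by the suffix at y is a
    subword of the suffix at x with one more [r]-pair than the suffix at y, so
    the label of x is larger. *)
Definition run_label r s x : nat := nadj r (drop (index x s) s).

Lemma run_label_le r s x :
  (forall y x z, r x z -> r x y || r y z) -> run_label r s x <= nadj r s.
Proof. by move=> r_cotrans; apply: nadj_subseq => //; apply: drop_subseq. Qed.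

Lemma pairwise_run_label r s :
    (forall y x z, r x z -> r x y || r y z) -> uniq s ->
  pairwise (fun x y => (run_label r s x == run_label r s y) ==> ~~ r x y) s.
Proof.
move=> r_cotrans; elim: s => //= x s IHs /andP[x_s uniq_s].
have label_s y : y \in s -> run_label r (x :: s) y = run_label r s y.
  by move=> y_s; rewrite /run_label /=; case: eqP x_s => // ->; rewrite y_s.
apply/andP; split.
  apply/allP => y y_s; rewrite (label_s y y_s) /run_label /= eqxx /=.
  apply/implyP => /eqP eq_label; apply/negP => rxy.
  have := nadj_cons_subseq x r_cotrans (drop_subseq s (index y s)).
  by rewrite eq_label (drop_index y_s) nadj_cons2 rxy ltnn.
apply: (sub_in_pairwise (P := mem s)) (IHs uniq_s); last exact/allP.
by move=> y z y_s z_s; rewrite !label_s.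
Qed.

End AdjacentPairs.

Lemma card_nadj (r : rel nat) (s : seq nat) :
  #|[set i : 'I_(size s).-1 | r (nth 0 s i) (nth 0 s i.+1)]| = nadj r s.
Proof.
rewrite -sum1dep_card big_mkcond /=.
elim: s => [|x [|y s] IHs]; rewrite /= ?big_ord0 //.
by rewrite big_ord_recl nadj_cons2 -IHs.
Qed.

(** * Descents and ascents *)

Lemma des_nadj s : des s = nadj gtn s.
Proof. exact: (card_nadj gtn). Qed.

Lemma asc_nadj s : asc s = nadj ltn s.
Proof. exact: (card_nadj ltn). Qed.

Lemma gtn_cotrans (y x z : nat) : gtn x z -> gtn x y || gtn y z.
Proof. by move=> /= z_x; case: (ltnP y x) => //= /(leq_trans z_x). Qed.

Lemma ltn_cotrans (y x z : nat) : ltn x z -> ltn x y || ltn y z.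
Proof. by move=> /= x_z; case: (ltnP x y) => //= /leq_ltn_trans ->. Qed.

Lemma des_subseq s t : subseq s t -> des s <= des t.
Proof. by rewrite !des_nadj; apply: nadj_subseq gtn_cotrans. Qed.

Lemma asc_subseq s t : subseq s t -> asc s <= asc t.
Proof. by rewrite !asc_nadj; apply: nadj_subseq ltn_cotrans. Qed.

Lemma size_asc_des s : uniq s -> size s = asc s + des s + (s != [::]).
Proof.
rewrite asc_nadj des_nadj; elim: s => [|x [|y s] IHs] // /andP[x_ys uniq_ys].
rewrite /= in IHs *; rewrite (IHs uniq_ys) !nadj_cons2 /= !addn1 addnACA.
have : x != y by move: x_ys; rewrite inE; case: eqP.
by rewrite neq_ltn; case: ltngtP.
Qed.

Lemma des_sorted s : sorted ltn s -> des s = 0.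
Proof.
rewrite des_nadj; elim: s => [|x [|y s] IHs] //= /andP[x_y /IHs des_ys].
by rewrite nadj_cons2 des_ys /= ltnNge (ltnW x_y).
Qed.

(** * Subwords of a permutation *)

Section Subwords.

Variables (n : nat) (pi : 'S_n).
Implicit Types I J : {set 'I_n}.

Lemma word_subword : word pi = subword pi setT.
Proof. by rewrite /word /subword enum_setT enumT. Qed.

Lemma size_subword I : size (subword pi I) = #|I|.
Proof. by rewrite size_map cardE. Qed.

Lemma subword_uniq I : uniq (subword pi I).
Proof. by rewrite map_inj_uniq ?enum_uniq // => i j /val_inj /perm_inj. Qed.

Lemma enum_setIf I (P : pred 'I_n) :
  enum [set i in I | P i] = [seq i <- enum I | P i].
Proof.
rewrite [in RHS]/enum_mem -filter_predI /enum_mem.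
by apply: eq_filter => i /=; rewrite [LHS]in_set andbC.
Qed.

Lemma subword_subseq I J : I \subset J -> subseq (subword pi I) (subword pi J).
Proof.
move=> /setIidPr <-; apply: map_subseq.
by rewrite enum_setIf filter_subseq.
Qed.

(** The upper estimate is the monotonicity of ascents: the length of the word
    exceeds the sum of ascents and descents by one, or by zero if the word is
    empty, and it grows by at most one while the ascents do not decrease. *)
Lemma des_subwordU1 I x :
  des (subword pi I) <= des (subword pi (x |: I)) <= (des (subword pi I)).+1.
Proof.
have I_xI := subword_subseq (subsetU1 x I).
rewrite (des_subseq I_xI) /=; have asc_le := asc_subseq I_xI.
have nil_le : (subword pi I != [::]) <= (subword pi (x |: I) != [::]).
  by case: (subword pi (x |: I)) I_xI => [/eqP -> | b t _] //; rewrite leq_b1.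
have size_le : size (subword pi (x |: I)) <= (size (subword pi I)).+1.
  by rewrite !size_subword cardsU1 -add1n leq_add2r leq_b1.
rewrite -(leq_add2l (asc (subword pi (x |: I)))).
rewrite -(leq_add2r (subword pi (x |: I) != [::])) -size_asc_des ?subword_uniq //.
apply: leq_trans size_le _; rewrite size_asc_des ?subword_uniq // -addSn -addnS.
by rewrite leq_add // leq_add2r.
Qed.

(** Induction on d cannot go through [ls] alone, since the maximum over an empty
    range is 0; the witness shows that the range is nonempty. *)
Lemma exists_des_card_ge_lis d : d <= des (word pi) ->
  exists2 I : {set 'I_n}, des (subword pi I) == d & lis pi + d <= #|I|.
Proof.
elim: d => [_|d IHd d_lt].
  have inc0 : increasing_on pi set0 by rewrite /increasing_on /subword enum_set0.
  rewrite /lis (bigmax_eq_arg _ inc0); case: arg_maxnP => // I inc_I _.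
  by exists I; rewrite ?addn0 // des_sorted.
have [I0 des_I0 card_I0] := IHd (ltnW d_lt).
have [I /eqP des_I I_max] := @arg_maxnP _ I0
  (fun I => des (subword pi I) == d) (fun I => #|I|) des_I0.
have /subsetPn[x _ xI] : ~~ (setT \subset I).
  apply/negP; rewrite subTset => /eqP I_T.
  by move: d_lt; rewrite word_subword -I_T des_I ltnn.
have card_xI : #|x |: I| = #|I|.+1 by rewrite cardsU1 xI.
exists (x |: I); last first.
  rewrite card_xI addnS ltnS; exact: leq_trans card_I0 (I_max _ des_I0).
have /andP[] := des_subwordU1 I x; rewrite des_I leq_eqVlt => /orP[|].
  by rewrite eq_sym => /I_max; rewrite /= card_xI ltnn.
by move=> ge_d le_d; rewrite eqn_leq le_d ge_d.
Qed.

(** The family consists of the runs of pi_I between consecutive descents. *)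
Lemma k_increasing_des I : k_increasing_on (des (subword pi I)).+1 pi I.
Proof.
set s := subword pi I; set k := (des s).+1.
pose label (i : 'I_n) := run_label gtn s (pi i).
pose J := [ffun j : 'I_k => [set i in I | label i == j]].
apply/existsP; exists J; apply/andP; split.
  apply/forallP => j; rewrite /increasing_on ltn_sorted_uniq_leq subword_uniq.
  rewrite (sorted_pairwise leq_trans) ffunE.
  have -> : subword pi [set i in I | label i == j]
          = [seq a <- s | run_label gtn s a == j].
    by rewrite /subword enum_setIf filter_map.
  have := subseq_pairwise (filter_subseq (fun a => run_label gtn s a == j) s)
            (pairwise_run_label gtn_cotrans (subword_uniq I)).
  apply: sub_in_pairwise (filter_all _ s) => a b /eqP + /eqP + => /= -> ->.
  by rewrite eqxx -leqNgt.
apply/eqP/setP => i; apply/idP/bigcupP => [i_I|[j _]]; last first.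
  by rewrite ffunE inE => /andP[].
have label_lt : label i < k.
  by rewrite ltnS des_nadj run_label_le //; apply: gtn_cotrans.
by exists (Ordinal label_lt); rewrite // ffunE inE i_I /=.
Qed.

Lemma card_le_asc_des I : #|I| <= asc (word pi) + des (subword pi I) + 1.
Proof.
rewrite -size_subword (size_asc_des (subword_uniq I)) leq_add ?leq_b1 //.
by rewrite leq_add2r asc_subseq // word_subword subword_subseq ?subsetT.
Qed.

End Subwords.

Theorem lemma3p4 (n : nat) (n_ge1 : 1 <= n) (pi : 'S_n) (d : nat)
    (hd : d <= des (word pi)) :
  lis pi + d <= ls d pi <= minn (lis_k d.+1 pi) (asc (word pi) + d + 1).
Proof.
apply/andP; split.
  have [I des_I card_I] := exists_des_card_ge_lis hd.
  exact: leq_trans card_I (leq_bigmax_cond _ des_I).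
apply/bigmax_leqP => I /eqP <-; rewrite leq_min card_le_asc_des andbT.
exact: leq_bigmax_cond (k_increasing_des pi I).
Qed.
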